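(* Let $(X,\mathcal{E})$ and $(Y,\mathcal{F})$ be coarse spaces and suppose that $f:X\to Y$ is a coarse map. For a family $\mathcal{V}$ of subsets of $Y$ write $f^{-1}(\mathcal{V})=\{f^{-1}(V)\mid V\in\mathcal{V}\}$. (1) Suppose that $Y$ has finite weak coarse decomposition complexity and that for every uniformly bounded family $\mathcal{V}$ of subsets of $Y$ the family $f^{-1}(\mathcal{V})$ has finite weak coarse decomposition complexity. Then $X$ has finite weak coarse decomposition complexity. (2) Suppose that $Y$ has finite coarse decomposition complexity and that for every uniformly bounded family $\mathcal{V}$ of subsets of $Y$ the family $f^{-1}(\mathcal{V})$ has finite coarse decomposition complexity. Then $X$ has finite coarse decomposition complexity. (3) Suppose that $Y$ has straight finite coarse decomposition complexity and that for every uniformly bounded family $\mathcal{V}$ of subsets of $Y$ the family $f^{-1}(\mathcal{V})$ has straight finite coarse decomposition complexity. Then $X$ has straight finite coarse decomposition complexity.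
   Context: A coarse structure on a set $X$ is a collection $\mathcal{E}$ of subsets of $X\times X$, called entourages, closed under subsets, finite unions, inverses $E^{-1}=\{(y,x)\mid (x,y)\in E\}$ and compositions $E_1\circ E_2=\{(x,z)\mid \exists y,\ (x,y)\in E_1,\ (y,z)\in E_2\}$, and containing the diagonal $\Delta_X$. The pair $(X,\mathcal{E})$ is a coarse space; subsets carry the restricted coarse structure. A subset $B$ is bounded if $B\times B\in\mathcal{E}$; a family $\mathcal{U}$ of subsets is uniformly bounded if $\bigcup_{U\in\mathcal{U}}(U\times U)\in\mathcal{E}$. A map $f:X\to Y$ of coarse spaces $(X,\mathcal{E}),(Y,\mathcal{F})$ is coarse if it is proper (preimages of bounded sets are bounded) and bornologous ($(f\times f)(E)\in\mathcal{F}$ for all $E\in\mathcal{E}$). Let $\mathcal{X},\mathcal{Y}$ be families of subsets of $X$ and $L\in\mathcal{E}$. For an integer $d\ge1$, a weak $(L,d)$-decomposition of a set $Z$ over $\mathcal{Y}$ is an expression $Z=Z^1\cup\cdots\cup Z^d$ where each $Z^i=\bigcup_j Z^i_j$ with all $Z^i_j\in\mathcal{Y}$, and, for each $i$, $Z^i_j\ne Z^i_{j'}$ implies $(Z^i_j\times Z^i_{j'})\cap L=\emptyset$. An $L$-decomposition is a weak $(L,2)$-decomposition. The family $\mathcal{X}$ admits an $L$-decomposition (resp. weak $(L,d)$-decomposition) over $\mathcal{Y}$ if every $Z\in\mathcal{X}$ does; write $\mathcal{X}\xrightarrow{L}\mathcal{Y}$ for the former. Coarse decomposition game for a family $\mathcal{X}$: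 set $\mathcal{Y}_0=\mathcal{X}$. In round $i\ge1$, Player 1 asserts an entourage $L_i$ and Player 2 responds with a family $\mathcal{Y}_i$ of subsets and an $L_i$-decomposition of $\mathcal{Y}_{i-1}$ over $\mathcal{Y}_i$. Player 2 wins if at some finite stage $\mathcal{Y}_i$ is uniformly bounded. In the weak coarse decomposition game, Player 2 instead responds with a positive integer $d_i$, a family $\mathcal{Y}_i$ and a weak $(L_i,d_i)$-decomposition of $\mathcal{Y}_{i-1}$ over $\mathcal{Y}_i$. The family $\mathcal{X}$ has finite (resp. finite weak) coarse decomposition complexity if Player 2 has a winning strategy in the (resp. weak) game. It has straight finite coarse decomposition complexity if for any sequence of entourages $L_1\subseteq L_2\subseteq\cdots$ there is a finite sequence of families $\mathcal{Y}_1,\ldots,\mathcal{Y}_n$ of subsets such that, with $\mathcal{Y}_0=\mathcal{X}$, $\mathcal{Y}_{i-1}\xrightarrow{L_i}\mathcal{Y}_i$ for $i=1,\ldots,n$ and $\mathcal{Y}_n$ is uniformly bounded. A space $X$ has one of these properties if the family $\{X\}$ does. *)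

(* Defs.v *)
From mathcomp Require Import all_boot.
From mathcomp Require Import boolp classical_sets.

Set Implicit Arguments.
Unset Strict Implicit.
Unset Printing Implicit Defensive.

Local Open Scope classical_set_scope.

(* The library notation [E2 \; E1] is
   [set (x, z) | exists y, (x, y) in E1 and (y, z) in E2]: it is the composition
   usually written E1 o E2 for entourages. The empty union needs no clause, as
   set0 is a subset of the diagonal. *)
Record coarse_structure (X : Type) (E : set (set (X * X))) : Prop :=
  CoarseStructure {
    coarse_sub : forall A B : set (X * X), A `<=` B -> E B -> E A;
    coarse_setU : forall A B : set (X * X), E A -> E B -> E (A `|` B);
    coarse_inv : forall A : set (X * X), E A -> E (A^-1)%relation;
    coarse_comp : forall E1 E2 : set (X * X),
      E E1 -> E E2 -> E (E2 \; E1)%relation;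
    coarse_diagonal : E diagonal
  }.

Definition coarse_bounded (X : Type) (E : set (set (X * X))) (B : set X) :
  Prop := E (B `*` B).

Definition uniformly_bounded (X : Type) (E : set (set (X * X)))
  (U : set (set X)) : Prop := E (\bigcup_(A in U) (A `*` A)).

Definition proper_map (X Y : Type) (E : set (set (X * X)))
  (F : set (set (Y * Y))) (f : X -> Y) : Prop :=
  forall B : set Y, coarse_bounded F B -> coarse_bounded E (f @^-1` B).

Definition bornologous (X Y : Type) (E : set (set (X * X)))
  (F : set (set (Y * Y))) (f : X -> Y) : Prop :=
  forall A : set (X * X), E A -> F ((fun p => (f p.1, f p.2)) @` A).

Definition coarse_map (X Y : Type) (E : set (set (X * X)))
  (F : set (set (Y * Y))) (f : X -> Y) : Prop :=
  proper_map E F f /\ bornologous E F f.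

(* [D i] is the set {Z^i_j | j} of pieces of Z^i; an indexing by j would carry
   no more information, since only pieces that differ as sets have to be
   L-disjoint. The quantification over A and B covers both orders, so L need
   not be symmetric. *)
Definition is_weak_decomposition (X : Type) (L : set (X * X)) (d : nat)
    (Z : set X) (YY : set (set X)) (D : 'I_d -> set (set X)) : Prop :=
  [/\ Z = \bigcup_(i in [set: 'I_d]) \bigcup_(A in D i) A,
      forall i, D i `<=` YY
    & forall i (A B : set X), D i A -> D i B -> A <> B ->
        (A `*` B) `&` L = set0].

Definition admits_weak_decomposition (X : Type) (L : set (X * X)) (d : nat)
    (XX YY : set (set X)) : Prop :=
  forall Z, XX Z ->
    exists D : 'I_d -> set (set X), is_weak_decomposition L Z YY D.

Definition admits_decomposition (X : Type) (L : set (X * X))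
  (XX YY : set (set X)) : Prop := admits_weak_decomposition L 2 XX YY.

(* A move of Player 2: the number d of parts, the new family, and for each
   member Z of the previous family its decomposition (the value at any other
   set is irrelevant). *)
Record response (X : Type) := Response {
  resp_num : nat;
  resp_family : set (set X);
  resp_dec : set X -> 'I_resp_num -> set (set X)
}.
Arguments resp_dec {X} r Z i : rename.

(* The argument is the list L_1, ..., L_i of all moves of Player 1 so far; the
   earlier moves of Player 2 are determined by it. *)
Definition strategy (X : Type) := seq (set (X * X)) -> response X.

(* Moves of Player 1 are numbered from 0: [L i] is the entourage asserted in
   round i + 1, and [game_family XX s L i] is the family Y_i after i rounds. *)
Definition game_response (X : Type) (s : strategy X)
  (L : nat -> set (X * X)) (i : nat) : response X := s (mkseq L i.+1).

Definition game_family (X : Type) (XX : set (set X)) (s : strategy X)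
    (L : nat -> set (X * X)) (i : nat) : set (set X) :=
  if i is j.+1 then resp_family (game_response s L j) else XX.

(* [P] is the set of numbers of parts that Player 2 may use. *)
Definition legal_round (X : Type) (P : set nat) (XX : set (set X))
    (s : strategy X) (L : nat -> set (X * X)) (i : nat) : Prop :=
  P (resp_num (game_response s L i)) /\
  forall Z, game_family XX s L i Z ->
    is_weak_decomposition (L i) Z (game_family XX s L i.+1)
      (resp_dec (game_response s L i) Z).

Definition winning_strategy (X : Type) (E : set (set (X * X))) (P : set nat)
    (XX : set (set X)) (s : strategy X) : Prop :=
  forall L : nat -> set (X * X), (forall i, E (L i)) ->
    exists n, (forall i, i < n -> legal_round P XX s L i) /\
      uniformly_bounded E (game_family XX s L n).

Definition finite_cdc (X : Type) (E : set (set (X * X)))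
    (XX : set (set X)) : Prop :=
  exists s : strategy X, winning_strategy E [set d | d = 2] XX s.

Definition finite_weak_cdc (X : Type) (E : set (set (X * X)))
    (XX : set (set X)) : Prop :=
  exists s : strategy X, winning_strategy E [set d | 0 < d] XX s.

(* [L i] stands for L_{i+1} and [YY i] for Y_i; the values of [YY] beyond n are
   irrelevant. *)
Definition straight_finite_cdc (X : Type) (E : set (set (X * X)))
    (XX : set (set X)) : Prop :=
  forall L : nat -> set (X * X),
    (forall i, E (L i)) -> (forall i, L i `<=` L i.+1) ->
    exists (n : nat) (YY : nat -> set (set X)),
      [/\ YY 0 = XX,
          forall i, i < n -> admits_decomposition (L i) (YY i) (YY i.+1)
        & uniformly_bounded E (YY n)].

Definition preimage_family (X Y : Type) (f : X -> Y) (V : set (set Y)) :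
  set (set X) := [set f @^-1` B | B in V].

(* Main.v *)
Require Import Defs.
From mathcomp Require Import all_boot.
From mathcomp Require Import boolp classical_sets.

Local Open Scope classical_set_scope.

(** The families from which Player 2 wins are the least class that contains the
uniformly bounded families and every family from which each move of Player 1
has an answer leading into the class. The preimage under [f] of a decomposition
for [(f x f)(L)] is a decomposition for [L], so by induction on this class it
suffices to win from the preimages of uniformly bounded families. In the
straight game one plays the sequence [(f x f)(L_i)] in the target, and after it
has ended at stage [n] the shifted sequence [L_(n + i)] in the source. *)

Definition push_entourage {X Y : Type} (f : X -> Y) (L : set (X * X)) :
  set (Y * Y) := (fun p => (f p.1, f p.2)) @` L.

(** Distinct preimages come from distinct pieces, and a pair of [L] between two preimages is sent by
    [f] to a pair of [push_entourage f L] between the pieces. *)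
Lemma weak_decomposition_preimage {X Y : Type} (f : X -> Y) (L : set (X * X))
    (d : nat) (B : set Y) (VV : set (set Y)) (D : 'I_d -> set (set Y)) :
  is_weak_decomposition (push_entourage f L) B VV D ->
  is_weak_decomposition L (f @^-1` B) (preimage_family f VV)
    (fun i => preimage_family f (D i)).
Proof.
move=> [-> DV disj]; split.
- apply/seteqP; split=> x /=.
    by move=> [i _ [A DA Ax]]; exists i => //; exists (f @^-1` A) => //; exists A.
  by move=> [i _ [_ [A DA <-] Ax]]; exists i => //; exists A.
- by move=> i _ [A DA <-]; exists A => //; exact: DV DA.
move=> i _ _ [A DA <-] [B' DB <-] neqAB.
have neq : A <> B' by move=> eqAB; apply: neqAB; rewrite eqAB.
apply/seteqP; split=> // -[x y] [[/= Ax By] Lxy].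
have : ((A `*` B') `&` push_entourage f L) (f x, f y).
  by split=> //; exists (x, y).
by rewrite (disj i A B' DA DB neq).
Qed.

Lemma admits_decomposition_preimage {X Y : Type} (f : X -> Y)
    (L : set (X * X)) (UU VV : set (set Y)) :
  admits_decomposition (push_entourage f L) UU VV ->
  admits_decomposition L (preimage_family f UU) (preimage_family f VV).
Proof.
move=> dec _ [B UB <-]; have [D decD] := dec B UB.
by exists (fun i => preimage_family f (D i)); exact: weak_decomposition_preimage.
Qed.

Lemma preimage_family_setT {X Y : Type} (f : X -> Y) :
  preimage_family f [set [set: Y]] = [set [set: X]].
Proof. by rewrite /preimage_family image_set1 preimage_setT. Qed.

(** A derivation is a well-founded game tree, so induction on it needs no histories of moves. *)
Inductive winning_position {X : Type} (E : set (set (X * X))) (P : set nat) :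
    set (set X) -> Prop :=
| winning_bounded XX : uniformly_bounded E XX -> winning_position E P XX
| winning_round XX (r : set (X * X) -> response X) :
    (forall L, E L -> P (resp_num (r L))) ->
    (forall L Z, E L -> XX Z ->
       is_weak_decomposition L Z (resp_family (r L)) (resp_dec (r L) Z)) ->
    (forall L, E L -> winning_position E P (resp_family (r L))) ->
    winning_position E P XX.

(** The first move is answered by [r]; it also selects the strategy [t] for the rest of the play,
    which sees the history without its head. *)
Lemma winning_position_strategy {X : Type} (E : set (set (X * X)))
    (P : set nat) (XX : set (set X)) :
  winning_position E P XX -> exists s, winning_strategy E P XX s.
Proof.
elim=> {XX} [XX ubXX | XX r Pr decr _ IH].
  exists (fun=> @Response X 0 set0 (fun _ _ => set0)) => L _.
  by exists 0; split.
have /choice[t wint] : forall L, exists t : strategy X,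
    E L -> winning_strategy E P (resp_family (r L)) t.
  move=> L; have [EL | nEL] := pselect (E L).
    by have [s ?] := IH L EL; exists s.
  by exists (fun=> r L).
pose s : strategy X := fun l =>
  match l with
  (* A history includes the current move, so this case never occurs in a play. *)
  | [::] => r set0
  | [:: L0] => r L0
  | L0 :: l' => t L0 l'
  end.
exists s => L EL.
have [n [legal ub]] := wint _ (EL 0) (L \o succn) (fun i => EL i.+1).
have respS i : game_response s L i.+1 = game_response (t (L 0)) (L \o succn) i.
  by rewrite /game_response /mkseq /= -[2]/(1 + 1) iotaDl -!map_comp.
have famS i : game_family XX s L i.+1
    = game_family (resp_family (r (L 0))) (t (L 0)) (L \o succn) i.
  by case: i => [|i] //=; rewrite respS.
exists n.+1; split; last by rewrite famS.
move=> [|i] lt_in.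
  by split; [exact: Pr | move=> Z XZ; exact: decr].
by have := legal i lt_in; rewrite /legal_round !famS respS.
Qed.

(** If the initial family were not winning, Player 1 could keep the play outside
the winning families for as long as the rounds are legal. *)
Lemma strategy_winning_position {X : Type} (E : set (set (X * X)))
    (P : set nat) (XX : set (set X)) (s : strategy X) :
  E diagonal -> winning_strategy E P XX s -> winning_position E P XX.
Proof.
move=> Ediag wins; apply: contrapT => losing.
pose fam (h : seq (set (X * X))) := if h is [::] then XX else resp_family (s h).
pose legal h L := P (resp_num (s (rcons h L))) /\
  forall Z, fam h Z -> is_weak_decomposition L Z
    (resp_family (s (rcons h L))) (resp_dec (s (rcons h L)) Z).
(* [g] is the evasion of Player 1. If it had no value at [h], the answers of [s] after [h] would
   form a winning round. *)
have /choice[g gP] : forall h, exists L,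
    E L /\ (~ winning_position E P (fam h) -> legal h L ->
      ~ winning_position E P (resp_family (s (rcons h L)))).
  move=> h; apply: contrapT => noL.
  have step L : E L ->
      legal h L /\ winning_position E P (resp_family (s (rcons h L))).
    move=> EL; apply: contrapT => nstep; apply: noL; exists L; split=> // _ lL wL.
    exact: nstep.
  (* Any entourage would do: [fam h] turns out to be winning, so the implication is vacuous. *)
  apply: noL; exists diagonal; split=> // nwin; exfalso; apply: nwin.
  apply: (@winning_round _ _ _ _ (fun L => s (rcons h L))) => [L|L Z|L] EL.
  - by case: (step L EL) => -[].
  - by move=> famZ; case: (step L EL) => -[_ dec] _; exact: dec.
  - by case: (step L EL).
(* The play in which Player 1 follows [g] against [s]. *)
pose hist := fix hist n := if n is m.+1 then rcons (hist m) (g (hist m)) else [::].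
pose L n := g (hist n).
have histE n : mkseq L n = hist n.
  by elim: n => // n IH; rewrite mkseqS IH.
have famE n : game_family XX s L n = fam (hist n).
  by case: n => // n; rewrite /game_family /game_response histE /=; case: (hist n).
have [n [legal_n ub]] := wins L (fun i => (gP (hist i)).1).
suff : ~ winning_position E P (game_family XX s L n).
  by apply; exact: winning_bounded.
elim: n legal_n {ub} => // n IH legal_n.
have nwin : ~ winning_position E P (game_family XX s L n).
  by apply: IH => i lt_in; apply: legal_n; exact: ltnW.
have [Pn decn] := legal_n n (ltnSn n).
have respE : game_response s L n = s (rcons (hist n) (g (hist n))).
  by rewrite /game_response histE.
rewrite /= respE in decn *; apply: (gP (hist n)).2; first by rewrite -famE.
by split; [rewrite -respE | rewrite -famE].
Qed.

Lemma winning_position_preimage {X Y : Type} (E : set (set (X * X)))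
    (F : set (set (Y * Y))) (f : X -> Y) (P : set nat) (VV : set (set Y)) :
  bornologous E F f ->
  (forall V, uniformly_bounded F V ->
     winning_position E P (preimage_family f V)) ->
  winning_position F P VV -> winning_position E P (preimage_family f VV).
Proof.
move=> bf base; elim=> {VV} [VV | VV r Pr decr _ IH]; first exact: base.
(* Different sets may have the same preimage, while the answer depends on [Z] alone; [b] fixes one
   set in the target for each [Z]. *)
have /choice[b bP] : forall Z, exists B : set Y,
    preimage_family f VV Z -> VV B /\ f @^-1` B = Z.
  move=> Z; have [[B VB <-] | nZ] := pselect (preimage_family f VV Z).
    by exists B.
  by exists set0.
pose q L := r (push_entourage f L).
apply: (@winning_round _ _ _ _ (fun L =>
  Response (preimage_family f (resp_family (q L)))
    (fun Z i => preimage_family f (resp_dec (q L) (b Z) i)))) => [L|L Z|L] EL /=.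
- exact/Pr/bf.
- move=> /bP[VbZ {1}<-]; apply: weak_decomposition_preimage.
  by apply: decr => //; exact: bf.
- exact/IH/bf.
Qed.

(** Stated for any [P] to cover the weak game and the game with two parts together. *)
Lemma winning_strategy_preimage {X Y : Type} (E : set (set (X * X)))
    (F : set (set (Y * Y))) (f : X -> Y) (P : set nat) (VV : set (set Y)) :
  E diagonal -> F diagonal -> bornologous E F f ->
  (exists s, winning_strategy F P VV s) ->
  (forall V, uniformly_bounded F V ->
     exists s, winning_strategy E P (preimage_family f V) s) ->
  exists s, winning_strategy E P (preimage_family f VV) s.
Proof.
move=> Ediag Fdiag bf [s wins] base; apply: winning_position_strategy.
apply: (winning_position_preimage _ F _ _ _ bf); last exact: strategy_winning_position wins.
by move=> V /base[t wint]; exact: strategy_winning_position wint.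
Qed.

Lemma straight_finite_cdc_preimage {X Y : Type} (E : set (set (X * X)))
    (F : set (set (Y * Y))) (f : X -> Y) (VV : set (set Y)) :
  bornologous E F f -> straight_finite_cdc F VV ->
  (forall V, uniformly_bounded F V ->
     straight_finite_cdc E (preimage_family f V)) ->
  straight_finite_cdc E (preimage_family f VV).
Proof.
move=> bf cdcF base L EL Lmono.
have [n [V [V0 decV ubV]]] := cdcF (fun i => push_entourage f (L i))
  (fun i => bf _ (EL i)) (fun i => image_subset (Lmono i)).
have Lshift i : L (n + i) `<=` L (n + i.+1) by rewrite addnS; exact: Lmono.
have [m [W [W0 decW ubW]]] := base (V n) ubV (fun i => L (n + i))
  (fun i => EL _) Lshift.
(* The two runs meet at stage [n], where [W 0] is the preimage of [V n]. *)
exists (n + m), (fun i => if i < n then preimage_family f (V i) else W (i - n)).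
split.
- by case: n V0 W0 {decV ubV decW Lshift} => [|n] /= <- // ->.
- move=> i lt_i; have [lt_in | le_ni] := ltnP i n.
    have := admits_decomposition_preimage f _ _ _ (decV i lt_in).
    case: (ltnP i.+1 n) => // le_ni.
    have eq_n : n = i.+1 by apply/eqP; rewrite eqn_leq le_ni lt_in.
    by rewrite -eq_n subnn W0.
  rewrite ltnNge (leq_trans le_ni (leqnSn i)) /= subSn //.
  rewrite -{1}(subnKC le_ni); apply: decW.
  by rewrite ltn_subLR.
- by rewrite ltnNge leq_addr /= addKn.
Qed.

Theorem theorem4p14 (X Y : Type) (E : set (set (X * X))) (F : set (set (Y * Y)))
    (hE : coarse_structure E) (hF : coarse_structure F)
    (f : X -> Y) (hf : coarse_map E F f) :
  [/\ finite_weak_cdc F [set [set: Y]] ->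
      (forall V : set (set Y), uniformly_bounded F V ->
         finite_weak_cdc E (preimage_family f V)) ->
      finite_weak_cdc E [set [set: X]],
      finite_cdc F [set [set: Y]] ->
      (forall V : set (set Y), uniformly_bounded F V ->
         finite_cdc E (preimage_family f V)) ->
      finite_cdc E [set [set: X]]
    & straight_finite_cdc F [set [set: Y]] ->
      (forall V : set (set Y), uniformly_bounded F V ->
         straight_finite_cdc E (preimage_family f V)) ->
      straight_finite_cdc E [set [set: X]]].
Proof.
have [_ bf] := hf.
have [Ediag Fdiag] := (coarse_diagonal hE, coarse_diagonal hF).
(* The whole source is the preimage of the whole target. *)
rewrite -(preimage_family_setT f).
by split; [exact: winning_strategy_preimage | exact: winning_strategy_preimage
  | exact: straight_finite_cdc_preimage].
Qed.
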